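(* Suppose that the matching policy $\phi$ is sub-additive and that (H1) holds, i.e. the stopping time $\tau_1(Y)$ is $\mathbb P^0$-integrable, for the initial conditions $Y\in\mathscr Y_2^\infty$. Then there exists a unique solution $U$ in $\mathscr Y_2^\infty$ to the ($\mathbb P^0$-almost sure) equation $$U\circ\theta=\left(U\odot_\phi(V^0,\Sigma^0)\right)\odot_\phi(V^1,\Sigma^1),$$ and all sequences $(U_n^{\{Y\}})_{n\in\mathbb N}$, for $Y\in\mathscr Y_2^\infty$, converge with strong backwards coupling to $(U\circ\theta^n)_{n\in\mathbb N}$; that is, for every $Y\in\mathscr Y_2^\infty$, $\mathbb P^0$-a.s. there exists a finite $N^*\ge0$ such that $U_n^{\{Y\}}\circ\theta^{-n}=U$ for all $n\ge N^*$.
   Context: Model. $G=(\mathcal V,\mathcal E)$ is a finite connected simple graph; $\mathcal E(v)$ is the set of neighbors of $v$. $\mathcal V^*$ is the set of finite words over $\mathcal V$, $|w|$ the length of $w$, $|w|_i$ the number of occurrences of $i$ in $w$, $\emptyset$ the empty word. $\mathbb W=\{w\in\mathcal V^*:|w|_i|w|_j=0\ \forall (i,j)\in\mathcal E\}$ is the set of buffer contents (classes of stored items in order of arrival), $\mathbb W_2=\{w\in\mathbb W:|w|\text{ even}\}$, $\mathbb W_2(r)=\{w\in\mathbb W_2:|w|\le 2r\}$ for $r\ge1$. $\mathcal S=\prod_{i\in\mathcal V}S_{\mathcal E(i)}$ is the set of lists of preferences ($S_A$ = permutations of $A$). An admissible matching policy $\phi$ consists of a probability distribution $\nu_\phi$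 on $\mathcal S$ and a map $\odot_\phi:\mathbb W\times(\mathcal V\times\mathcal S)\to\mathbb W$ such that $w\odot_\phi(v,\sigma)=wv$ if no letter of $w$ lies in $\mathcal E(v)$, and otherwise $w\odot_\phi(v,\sigma)$ is $w$ with one letter belonging to $\mathcal E(v)$ deleted, the deleted position being a function of $(w,v,\sigma)$. For $z=v_1\cdots v_n$, $\varsigma=\sigma_1\cdots\sigma_n$, $W_\phi(z,\varsigma)$ is obtained from $\emptyset$ by applying successively $\odot_\phi(v_1,\sigma_1),\dots,\odot_\phi(v_n,\sigma_n)$. $\phi$ is sub-additive if it is admissible and $|W_\phi(z'z'',\varsigma'\varsigma'')|\le|W_\phi(z',\varsigma')|+|W_\phi(z'',\varsigma'')|$ for all $z',z''\in\mathcal V^*$ and all $\varsigma',\varsigma''\in\mathcal S^*$ (finite words over $\mathcal S$) with $|\varsigma'|=|z'|$, $|\varsigma''|=|z''|$ whose letters can be drawn by $\nu_\phi$. Input. $\mu$ is a probability measure on $\mathcal V$ with full support. $\Omega^0=(\mathcal V\times\mathcal S\times\mathcal V\times\mathcal S)^{\mathbb Z}$ with its product $\sigma$-algebra and $\mathbb P^0=(\mu\otimes\nu_\phi\otimes\mu\otimes\nu_\phi)^{\otimes\mathbb Z}$; $\theta$ is the shift $\theta((\omega_n)_n)=(\omega_{n+1})_n$, and $(V^0,\Sigma^0,V^1,\Sigma^1)(\omega)=\omega_0$. For a $\mathbb W_2$-valued r.v. $Y$ on $\Omega^0$, set $U_0^{\{Y\}}=Y$ and $U_{n+1}^{\{Y\}}=\left(U_n^{\{Y\}}\odot_\phi(V^0\circ\theta^n,\Sigma^0\circ\theta^n)\right)\odot_\phi(V^1\circ\theta^n,\Sigma^1\circ\theta^n)$,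 $n\in\mathbb N$ (buffer content after pairs of arrivals). Let $\tau_1(Y)=\inf\{n>0:U_n^{\{Y\}}=\emptyset\}$. $\mathscr Y_2^\infty=\bigcup_{r\ge1}\mathscr Y_2^r$, where $\mathscr Y_2^r$ is the set of $\mathbb W_2(r)$-valued random variables on $\Omega^0$.
   Formalization: The solution U is sought among all W_2-valued random variables, not in Y_2^∞ (bounded ones), since no bounded solution exists: 4r+2 arrivals of one class have positive probability and push the content above 2r; uniqueness is among all W_2-valued solutions. *)

(* Defs.v *)
From HB Require Import structures.
From mathcomp Require Import all_boot all_order all_algebra all_fingroup.
From mathcomp Require Import all_classical all_reals all_analysis.

Set Implicit Arguments.
Unset Strict Implicit.
Unset Printing Implicit Defensive.

Import Order.TTheory GRing.Theory Num.Theory.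

Local Open Scope classical_set_scope.
Local Open Scope ring_scope.

Record graph := Graph {
  vertex :> finType;
  adj : rel vertex;
  adj_sym : symmetric adj;
  adj_irr : irreflexive adj;
  adj_connected : forall i j, connect adj i j;
  vertex_gt0 : (0 < #|vertex|)%N }.

Definition neighbors (G : graph) (i : G) : {set G} := [set j | adj i j].

(* Lists of preferences: the component at i is a permutation of the set of
   neighbors of i, i.e. a permutation of the vertices supported there. *)
Definition prefs (G : graph) :=
  {s : {ffun G -> {perm G}} | [forall i, perm_on (neighbors i) (s i)]}.

(* The words of W; W_2 and W_2(r) are the predicates even_buffer, buffer_le. *)
Definition admissible_word (G : graph) (w : seq G) : bool :=
  [forall i, forall j, adj i j ==> (count_mem i w * count_mem j w == 0)%N].

Definition buffer (G : graph) := {w : seq G | admissible_word w}.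

Lemma admissible_nil (G : graph) : admissible_word ([::] : seq G).
Proof. by apply/forallP => i; apply/forallP => j; apply/implyP. Qed.

Definition buffer0 (G : graph) : buffer G := exist _ [::] (admissible_nil G).

HB.instance Definition _ (G : graph) := Countable.on (buffer G).
HB.instance Definition _ (G : graph) := isPointed.Build (buffer G) (buffer0 G).
HB.instance Definition _ (G : graph) :=
  @isMeasurable.Build default_measure_display (buffer G) discrete_measurable
    discrete_measurable0 discrete_measurableC discrete_measurableU.

Definition buffer_size (G : graph) (w : buffer G) : nat := size (sval w).
Definition even_buffer (G : graph) (w : buffer G) : bool :=
  ~~ odd (buffer_size w).
Definition buffer_le (G : graph) (r : nat) (w : buffer G) : bool :=
  even_buffer w && (buffer_size w <= 2 * r)%N.

Definition is_distribution (R : realType) (T : finType) (p : T -> R) : Prop :=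
  (forall x, 0 <= p x) /\ \sum_x p x = 1.

(* An admissible policy. [odot w (v, s)] is the content of the buffer after the
   arrival of v with list of preferences s; the deleted position k depends on
   (w, v, s) only, since [odot] does. *)
Record policy (R : realType) (G : graph) := Policy {
  nu : prefs G -> R;
  nu_distribution : is_distribution nu;
  odot : buffer G -> G * prefs G -> buffer G;
  odot_unmatched : forall (w : buffer G) (v : G) (s : prefs G),
    ~~ has (adj v) (sval w) -> sval (odot w (v, s)) = rcons (sval w) v;
  odot_matched : forall (w : buffer G) (v : G) (s : prefs G),
    has (adj v) (sval w) ->
    exists k : nat, [/\ (k < size (sval w))%N,
      adj v (nth v (sval w) k) &
      sval (odot w (v, s)) = take k (sval w) ++ drop k.+1 (sval w)] }.

Definition Wphi (R : realType) (G : graph) (phi : policy R G)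
    (z : seq G) (s : seq (prefs G)) : buffer G :=
  foldl (odot phi) (buffer0 G) (zip z s).

Definition drawable (R : realType) (G : graph) (phi : policy R G)
    (s : seq (prefs G)) : bool := all (fun a => 0 < nu phi a) s.

Definition sub_additive (R : realType) (G : graph) (phi : policy R G) : Prop :=
  forall (z1 z2 : seq G) (s1 s2 : seq (prefs G)),
    size s1 = size z1 -> size s2 = size z2 ->
    drawable phi s1 -> drawable phi s2 ->
    (buffer_size (Wphi phi (z1 ++ z2) (s1 ++ s2)) <=
     buffer_size (Wphi phi z1 s1) + buffer_size (Wphi phi z2 s2))%N.

(* V x S x V x S, bracketed by pairs: a term is ((v0, s0), (v1, s1)). *)
Definition arrivals (G : graph) := ((G * prefs G) * (G * prefs G))%type.

Lemma vertex_inhabited (G : graph) : exists v : G, true.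
Proof. by have /card_gt0P[v _] := vertex_gt0 G; exists v. Qed.

Definition vertex0 (G : graph) : G := xchoose (vertex_inhabited G).

Lemma prefs0_subproof (G : graph) :
  [forall i, perm_on (neighbors i) (([ffun=> 1%g] : {ffun G -> {perm G}}) i)].
Proof. by apply/forallP => i; rewrite ffunE perm_on1. Qed.

Definition prefs0 (G : graph) : prefs G := exist _ [ffun=> 1%g] (prefs0_subproof G).

(* The library's measurable types are pointed, hence the points above. *)
Definition arrivals_seq (G : graph) := int -> arrivals G.
HB.instance Definition _ (G : graph) := gen_eqMixin (arrivals_seq G).
HB.instance Definition _ (G : graph) := gen_choiceMixin (arrivals_seq G).
HB.instance Definition _ (G : graph) := isPointed.Build (arrivals_seq G)
  (fun _ => ((vertex0 G, prefs0 G), (vertex0 G, prefs0 G))).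

Definition coordinate_sets (G : graph) : set (set (arrivals_seq G)) :=
  [set C | exists (n : int) (B : {set arrivals G}), C = [set w | w n \in B]].

(* Omega^0 with its product sigma-algebra (the factors are finite and carry the
   discrete sigma-algebra). *)
Definition Omega (G : graph) := g_sigma_algebraType (@coordinate_sets G).

Definition arrivals_law (R : realType) (G : graph) (mu : G -> R)
    (nu : prefs G -> R) (a : arrivals G) : R :=
  mu a.1.1 * nu a.1.2 * (mu a.2.1 * nu a.2.2).

(* P is the product measure (mu x nu x mu x nu)^Z, which is determined by its
   values on finite-dimensional rectangles. *)
Definition is_product_measure (R : realType) (G : graph) (mu : G -> R)
    (nu : prefs G -> R) (P : probability (Omega G) R) : Prop :=
  forall (s : seq int) (B : int -> {set arrivals G}), uniq s ->
    P [set w : Omega G | forall n, n \in s -> w n \in B n] =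
    (\prod_(n <- s) \sum_(a in B n) arrivals_law mu nu a)%:E.

(* [shift k] is the k-th iterate of the shift theta, for any integer k. *)
Definition shift (G : graph) (k : int) (w : Omega G) : Omega G :=
  fun n : int => w (n + k).

(* The pairs (V^0, Sigma^0) and (V^1, Sigma^1). *)
Definition VS0 (G : graph) (w : Omega G) : G * prefs G := (w 0).1.
Definition VS1 (G : graph) (w : Omega G) : G * prefs G := (w 0).2.

Fixpoint U_ (R : realType) (G : graph) (phi : policy R G)
    (Y : Omega G -> buffer G) (n : nat) (w : Omega G) : buffer G :=
  if n is m.+1 then
    odot phi (odot phi (U_ phi Y m w) (VS0 (shift m%:Z w))) (VS1 (shift m%:Z w))
  else Y w.

Definition tau1 (R : realType) (G : graph) (phi : policy R G)
    (Y : Omega G -> buffer G) (w : Omega G) : \bar R :=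
  ereal_inf [set (n%:R)%:E | n in
    [set n : nat | (0 < n)%N /\ U_ phi Y n w = buffer0 G]].

(* All W_2-valued random variables: the class in which stationary solutions are
   sought. No solution is uniformly bounded, i.e. lies in Y2inf below: if
   buffer_le r (U w) for a.e. w, then 4 r + 2 consecutive arrivals of one and
   the same class, which have positive probability, lead to a content of size
   greater than 2 r, contradicting the equation. *)
Definition Y2rv (G : graph) : set {mfun Omega G >-> buffer G} :=
  [set Y | forall w, even_buffer (Y w)].

Definition Y2 (G : graph) (r : nat) : set {mfun Omega G >-> buffer G} :=
  [set Y | forall w, buffer_le r (Y w)].

Definition Y2inf (G : graph) : set {mfun Omega G >-> buffer G} :=
  \bigcup_(r in [set r : nat | (1 <= r)%N]) @Y2 G r.

Definition H1 (R : realType) (G : graph) (phi : policy R G)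
    (P : probability (Omega G) R) : Prop :=
  forall Y : {mfun Omega G >-> buffer G}, Y2inf Y ->
    P.-integrable [set: Omega G] (tau1 phi Y).

Definition is_solution (R : realType) (G : graph) (phi : policy R G)
    (P : probability (Omega G) R) (U : Omega G -> buffer G) : Prop :=
  {ae P, forall w, U (shift 1 w) = odot phi (odot phi (U w) (VS0 w)) (VS1 w)}.

Definition strong_backwards_coupling (R : realType) (G : graph)
    (phi : policy R G) (P : probability (Omega G) R)
    (Y U : Omega G -> buffer G) : Prop :=
  {ae P, forall w, exists N : nat, forall n : nat, (N <= n)%N ->
    U_ phi Y n (shift (- n%:Z) w) = U w}.

(* Main.v *)
Require Import Defs.
From HB Require Import structures.
From mathcomp Require Import all_boot all_order all_algebra all_fingroup.
From mathcomp Require Import all_classical all_reals all_analysis.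
From mathcomp Require Import measurable_realfun.
From mathcomp Require Import zify ring lra.
Import Order.TTheory GRing.Theory Num.Theory.
Import numFieldNormedType.Exports.
Local Open Scope classical_set_scope.
Local Open Scope ring_scope.

(** Start the system empty at time - n and look at the content at time 0. The
    stationary solution is the almost sure limit, in fact the ultimate value, of
    this content as n grows. Everything rests on one estimate: if two systems,
    one empty and the other with a bounded even content, are fed by the same
    arrivals, then the time after which they coincide has a finite mean.

    The estimate yields the theorem by the Borel-Cantelli lemma. The probability
    that the systems started at time - n from the empty content and from x have
    not coalesced at time 0 is the probability that the coalescence time exceeds
    n, by stationarity, and these probabilities have a finite sum. Almost surely,
    then, for each x the two backward contents agree for all large n
    ([ae_coalescing]). Starting at time - n - 1 rather than - n means starting at
    time - n from a content of size at most 2, so the backward contents are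
    ultimately constant; as there are finitely many contents of bounded size, any
    bounded initial condition, even one that depends on the arrivals, leads to
    the same value. The limit solves the equation because shifting the arrivals
    by 1 moves time 0 to time 1. A second solution is large at time - n only with
    a probability that does not depend on n and is small; otherwise it is one of
    finitely many contents, and it coincides with the first at time 0 but for a
    probability that vanishes as n grows ([solutions_differ_le]).

    The estimate combines three facts.

    - Erasing words exist ([even_erasable]): each even content y has a word of
      arrivals that leads both y and the empty content to the empty content. For
      two stored items at the ends of a walk of odd length, arrivals of the next
      two classes of the walk shorten it by 2; by sub-additivity, two items can
      be erased from a content of any size.
    - Walks of odd length join all pairs of vertices ([recurrent_odd_walk]).
      Otherwise the graph is 2-coloured, and the number of stored items of one
      colour minus that of the other is a random walk, whatever the policy does.
      A random walk with bounded steps takes a time of infinite mean to reach 0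
      from the side from which its drift does not help, whereas the integrability
      of the return times makes the hitting times of the empty content integrable
      from every even content.
    - When the system that started empty is empty again, sub-additivity bounds
      the size of the other one by its initial size ([exceeds_empty]). So there
      are infinitely many trials, separated by times of bounded mean, at each of
      which an erasing word follows with a probability bounded below
      ([coal_bounded]).

    Only probabilities of events that depend on finitely many arrivals occur in
    the estimate. They are computed by a recursion on the number of arrivals
    ([prob]), which [window_law] identifies with the product measure. *)

Set Implicit Arguments.
Unset Strict Implicit.
Unset Printing Implicit Defensive.

(* Elsewhere this name stands for the translations of a group. *)
Local Notation shift := Defs.shift.

(** * Contents and arrivals *)

Section Dynamics.
Context (R : realType) (G : graph) (phi : policy R G).
Implicit Types (x y : buffer G) (u v : G) (a : arrivals G).

Definition run1 : buffer G -> seq (G * prefs G) -> buffer G := foldl (odot phi).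

Definition pair_step x a : buffer G := odot phi (odot phi x a.1) a.2.

Definition run : buffer G -> seq (arrivals G) -> buffer G := foldl pair_step.

Definition unpair (z : seq (arrivals G)) : seq (G * prefs G) :=
  flatten [seq [:: a.1; a.2] | a <- z].

Lemma run_unpair x z : run x z = run1 x (unpair z).
Proof. by elim: z x => //= a z IH x; rewrite IH. Qed.

Lemma run_cat x z1 z2 : run x (z1 ++ z2) = run (run x z1) z2.
Proof. exact: foldl_cat. Qed.

Lemma admissible_wordP (w : seq G) :
  reflect {in w &, forall u v, ~~ adj u v} (admissible_word w).
Proof.
apply: (iffP forallP) => [H u v uw vw|H u].
  apply/negP => uv; have /forallP/(_ v)/implyP/(_ uv) := H u.
  by rewrite muln_eq0 !eqn0Ngt -!has_count !has_pred1 uw vw.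
apply/forallP => v; apply/implyP => uv.
rewrite muln_eq0 !eqn0Ngt -!has_count !has_pred1 -negb_and.
by apply/negP => /andP[uw vw]; move: (H _ _ uw vw); rewrite uv.
Qed.

Lemma buffer_nadj x u v : u \in sval x -> v \in sval x -> ~~ adj u v.
Proof. by move: u v; apply/admissible_wordP; case: x. Qed.

Lemma buffer_eq0 x : (x == buffer0 G) = (buffer_size x == 0)%N.
Proof. by rewrite -val_eqE /buffer_size size_eq0. Qed.

Lemma odot_cases x (b : G * prefs G) :
  sval (odot phi x b) = rcons (sval x) b.1 \/
  exists2 u, adj b.1 u & perm_eq (sval x) (u :: sval (odot phi x b)).
Proof.
case: b => v s /=; case: (boolP (has (adj v) (sval x))) => H; last first.
  by left; exact: odot_unmatched.
have [k [kx vk ->]] := odot_matched phi s H.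
right; exists (nth v (sval x) k) => //.
rewrite -{1}(cat_take_drop k (sval x)) (drop_nth v) //.
by rewrite perm_catC /= perm_cons perm_catC.
Qed.

Lemma odot_size x b :
  buffer_size (odot phi x b) = (buffer_size x).+1 \/
  buffer_size x = (buffer_size (odot phi x b)).+1.
Proof.
rewrite /buffer_size; case: (odot_cases x b) => [->|[u _ /perm_size]].
  by rewrite size_rcons; left.
by right.
Qed.

Lemma pair_step_even x a : even_buffer (pair_step x a) = even_buffer x.
Proof.
rewrite /even_buffer /pair_step.
by case: (odot_size x a.1) (odot_size (odot phi x a.1) a.2) => H1 [] H2; lia.
Qed.

Lemma pair_step_size x a :
  (buffer_size (pair_step x a) <= (buffer_size x).+2)%N.
Proof.
rewrite /pair_step.
by case: (odot_size x a.1) (odot_size (odot phi x a.1) a.2) => H1 [] H2; lia.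
Qed.

Lemma run_even x z : even_buffer (run x z) = even_buffer x.
Proof. by elim: z x => //= a z IH x; rewrite IH pair_step_even. Qed.

Lemma odot_sole x v s u : sval x = [:: u] -> adj v u ->
  odot phi x (v, s) = buffer0 G.
Proof.
move=> xu vu; have H : has (adj v) (sval x) by rewrite xu /= vu.
have [[|k] [+ _]] := odot_matched phi s H; rewrite xu //= => _ E.
by apply/val_inj.
Qed.

Lemma odot_nil v s : sval (odot phi (buffer0 G) (v, s)) = [:: v].
Proof. exact: odot_unmatched. Qed.

(** Since its letters are pairwise compatible, an admissible word is stored
   unchanged: every content is reached from the empty one, so sub-additivity
   also speaks of runs from arbitrary contents. *)
Lemma run1_word (s0 : prefs G) (w : seq G) x y : sval y = sval x ++ w ->
  run1 x [seq (v, s0) | v <- w] = y.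
Proof.
elim: w x => [|v w IH] x /= yE; first by apply/val_inj; rewrite /= yE cats0.
apply: IH; rewrite odot_unmatched ?cat_rcons //.
apply/hasPn => u ux; apply: (@buffer_nadj y);
  by rewrite yE mem_cat ?ux ?orbT //= mem_head orbT.
Qed.

Definition drawable_arrival a : bool := (0 < nu phi a.1.2) && (0 < nu phi a.2.2).

Definition drawable_arrivals (z : seq (arrivals G)) : bool :=
  all drawable_arrival z.

Lemma exists_drawable : exists s0 : prefs G, 0 < nu phi s0.
Proof.
have [ge0 s1] := nu_distribution phi.
have /existsP : [exists s, 0 < nu phi s]; last by [].
apply: contraT => /existsPn H.
have : (0 : R) = 1; last by move/eqP; rewrite eq_sym oner_eq0.
rewrite -s1 big1 // => s _; apply/le_anti; rewrite ge0 andbT leNgt; exact: H.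
Qed.

Lemma drawable_unpair z : drawable_arrivals z ->
  drawable phi [seq b.2 | b <- unpair z].
Proof. by elim: z => //= a z IH /andP[/andP[-> ->]] /IH. Qed.

Lemma Wphi_run1 (s : seq (G * prefs G)) :
  Wphi phi [seq b.1 | b <- s] [seq b.2 | b <- s] = run1 (buffer0 G) s.
Proof. by rewrite /Wphi zip_map; congr foldl; elim: s => //= -[? ?] s ->. Qed.

Section SubAdditive.
Hypothesis sub_add : sub_additive phi.

Lemma run1_sub_additive x (s : seq (G * prefs G)) :
  drawable phi [seq b.2 | b <- s] ->
  (buffer_size (run1 x s) <= buffer_size x + buffer_size (run1 (buffer0 G) s))%N.
Proof.
move=> ds; have [s0 s0_gt0] := exists_drawable.
pose sx := [seq (v, s0) | v <- sval x].
have xE : run1 (buffer0 G) sx = x by exact: run1_word.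
have := sub_add (z1 := [seq b.1 | b <- sx]) (z2 := [seq b.1 | b <- s])
  (s1 := [seq b.2 | b <- sx]) (s2 := [seq b.2 | b <- s]).
rewrite !size_map -!map_cat !Wphi_run1 {1}/run1 foldl_cat -!/(run1 _ _) xE.
by apply=> //; rewrite /drawable -map_comp all_map; apply/allP => ? _.
Qed.

Lemma run_sub_additive x z : drawable_arrivals z ->
  (buffer_size (run x z) <= buffer_size x + buffer_size (run (buffer0 G) z))%N.
Proof.
by move=> dz; rewrite !run_unpair run1_sub_additive // drawable_unpair.
Qed.

(** Sub-additivity with the last letters of the content counted among the later
   arrivals: the other letters add at most their number to the final size. *)
Lemma run_sub_additive_suffix x (w : seq G) y x' z :
  sval x = sval x' ++ w -> sval y = w -> drawable_arrivals z ->
  (buffer_size (run x z) <= buffer_size x' + buffer_size (run y z))%N.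
Proof.
move=> xE yE dz; have [s0 s0_gt0] := exists_drawable.
rewrite !run_unpair -(run1_word s0 xE) -(@run1_word s0 w (buffer0 G) y) //.
rewrite /run1 -!foldl_cat; apply: run1_sub_additive.
rewrite map_cat /drawable all_cat -/(drawable phi (map _ (unpair z))).
rewrite drawable_unpair // andbT /drawable.
by rewrite -map_comp all_map; apply/allP.
Qed.

End SubAdditive.
End Dynamics.

(** * Walks of odd length *)

Section Walks.
Context (G : graph).
Implicit Types i j k : G.

Fixpoint walk n i j : Prop :=
  if n is m.+1 then exists2 k, adj i k & walk m k j else i = j.

Lemma walk_cat m n i j k : walk m i j -> walk n j k -> walk (m + n) i k.
Proof.
elim: m i => [|m IH] i /=; first by move=> ->.
by move=> [l il lj] jk; exists l => //; exact: IH.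
Qed.

Lemma walk_rcons n i j k : walk n i j -> adj j k -> walk n.+1 i k.
Proof. by move=> ij jk; rewrite -addn1; apply: walk_cat ij _; exists k. Qed.

Lemma walk_rconsP n i k : walk n.+1 i k -> exists2 j, walk n i j & adj j k.
Proof.
elim: n i => [|n IH] i [l il]; first by move=> /= <-; exists i.
by move=> /IH[j lj jk]; exists j => //; exists l.
Qed.

Lemma walk_sym n i j : walk n i j -> walk n j i.
Proof.
elim: n i => [|n IH] i /=; first by move=> ->.
by case=> k ik /IH kj; apply: walk_rcons kj _; rewrite adj_sym.
Qed.

Lemma connected_walk i j : exists n, walk n i j.
Proof.
have /connectP[p] := adj_connected i j.
elim: p i => [|k p IH] i /=; first by move=> _ ->; exists 0%N.
by move=> /andP[ik /IH{}IH] /IH[n kj]; exists n.+1, k.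
Qed.

Definition two_colouring (c : G -> bool) := forall i j, adj i j -> c j = ~~ c i.

(** In a connected graph, if one pair of vertices is joined by no walk of odd
   length, then from a given vertex each vertex is reached by walks of one
   parity only, and this parity is a proper colouring. *)
Lemma odd_walk_or_two_colouring :
  (forall i j, exists m, walk m.*2.+1 i j) \/ (exists c, two_colouring c).
Proof.
have [H|] := pselect (forall i j, exists m, walk m.*2.+1 i j); first by left.
move=> /existsNP[i /existsNP[j nij]]; right.
pose reach (b : bool) k := exists n, walk (n.*2 + b) i k.
have reachS b k l : adj k l -> reach b k -> reach (~~ b) l.
  move=> kl [n ik]; have := walk_rcons ik kl; rewrite /reach.
  case: b {ik} => /= il; [exists n.+1|exists n].
    by have -> : (n.+1.*2 + 0 = (n.*2 + 1).+1)%N by lia.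
  by have -> : (n.*2 + 1 = (n.*2 + 0).+1)%N by lia.
have reach1 k : reach false k \/ reach true k.
  have [n ik] := connected_walk i k.
  rewrite -(odd_double_half n) addnC in ik.
  by case: (odd n) ik => ik; [right|left]; exists n./2.
(* From a vertex reached with both parities, j would be too. *)
have noboth k : reach false k -> reach true k -> False.
  move=> [n0 ik0] [n1 ik1]; apply: nij.
  have [m kj] := connected_walk k j.
  rewrite -(odd_double_half m) in kj.
  case: (odd m) kj => kj; [exists (n0 + m./2)%N|exists (n1 + m./2)%N].
    have -> : ((n0 + m./2).*2.+1 = n0.*2 + false + (true + m./2.*2))%N by lia.
    exact: walk_cat ik0 kj.
  have -> : ((n1 + m./2).*2.+1 = n1.*2 + true + (false + m./2.*2))%N by lia.
  exact: walk_cat ik1 kj.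
exists (fun k => `[< reach true k >]) => k l kl.
apply/idP/idP => [/asboolP rl|/asboolP rk].
  by apply/asboolP => /(reachS _ _ _ kl) /noboth; apply.
apply/asboolP; case: (reach1 k) => [/(reachS _ _ _ kl)//|//].
Qed.

End Walks.

(** * Erasing words *)

Section Erasing.
Context (R : realType) (G : graph) (phi : policy R G).
Implicit Types (x y : buffer G) (i j k : G).

(** That the word also leaves the empty content empty makes the two contents
   coalesce, and lets erasing words be concatenated. *)
Definition erasable y := exists z : seq (arrivals G),
  [/\ drawable_arrivals phi z, run phi (buffer0 G) z = buffer0 G &
      run phi y z = buffer0 G].

(** A pair of adjacent arrivals leaves the empty content empty, so it may be
   put in front of an erasing word. *)
Lemma erasable_step y s0 i j : 0 < nu phi s0 -> adj i j ->
  erasable (pair_step phi y ((i, s0), (j, s0))) -> erasable y.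
Proof.
move=> s0_gt0 ij [z [dz z0 zy]]; exists (((i, s0), (j, s0)) :: z); split => //.
  by rewrite /drawable_arrivals /= /drawable_arrival /= s0_gt0.
rewrite /= /pair_step /= (@odot_sole _ _ _ _ j s0 i) ?odot_nil //.
by rewrite adj_sym.
Qed.

Lemma erasable0 : erasable (buffer0 G).
Proof. by exists [::]. Qed.

Definition content_of_two y i j := perm_eq (sval y) [:: i; j].

Lemma odot_of_one x j k s : sval x = [:: j] ->
  odot phi x (k, s) = buffer0 G \/ content_of_two (odot phi x (k, s)) k j.
Proof.
move=> xj; case: (boolP (adj k j)) => kj; first by left; exact: odot_sole xj kj.
right; rewrite /content_of_two odot_unmatched xj //=; last by rewrite (negbTE kj).
by rewrite perm_sym; apply/seq.permP => p /=; lia.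
Qed.

Lemma odot_of_two y i j k s : content_of_two y i j -> adj k i ->
  sval (odot phi y (k, s)) = [:: j] \/
  adj k j /\ sval (odot phi y (k, s)) = [:: i].
Proof.
move=> yij ki; case: (odot_cases phi y (k, s)) => /= [E|[u ku yu]].
  have : ~~ adj k i; last by rewrite ki.
  apply: (@buffer_nadj _ (odot phi y (k, s))); rewrite E mem_rcons ?mem_head //.
  by rewrite inE (perm_mem yij) mem_head orbT.
have uij : u \in [:: i; j] by rewrite -(perm_mem yij) (perm_mem yu) mem_head.
have perm1 v w : perm_eq [:: v; w] (v :: sval (odot phi y (k, s))) ->
    sval (odot phi y (k, s)) = [:: w].
  by rewrite perm_cons perm_sym => /perm_small_eq ->.
move: uij; rewrite !inE => /orP[]/eqP uE; subst u.
  by left; apply: perm1; apply: perm_trans yu; rewrite perm_sym.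
right; split => //; apply: perm1; apply: perm_trans yu.
rewrite perm_sym; apply: perm_trans yij _.
by apply/seq.permP => p /=; lia.
Qed.

(** Let i, i1, i2, ..., k, j be a walk of odd length between the two stored
   items. Feed i1 and then i2. The stored item that survives is j or, only if
   i1 is adjacent to j, i; in the latter case k is assumed adjacent to i, so
   in both cases the walk from i2 to k continues to the survivor, which gives
   an odd walk that is shorter by 2 between the two items left. *)
Lemma erasable_pair_step m i j i1 i2 k y :
  (forall i j y, walk m.*2.+1 i j -> content_of_two y i j -> erasable y) ->
  content_of_two y i j ->
  adj i i1 -> adj i1 i2 -> walk m.*2 i2 k -> adj k j ->
  ~~ adj i1 j \/ adj k i -> erasable y.
Proof.
move=> IH yij ii1 i12 i2k kj H; have [s0 s0_gt0] := exists_drawable phi.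
apply: (erasable_step s0_gt0 i12); rewrite /pair_step /=.
have i1i : adj i1 i by rewrite adj_sym.
case: (odot_of_two s0 yij i1i) => [E|[i1j E]].
  case: (odot_of_one i2 s0 E) => [->|]; first exact: erasable0.
  by apply: IH; exact: walk_rcons i2k kj.
case: (odot_of_one i2 s0 E) => [->|]; first exact: erasable0.
apply: IH; apply: walk_rcons i2k _.
by case: H => //; rewrite i1j.
Qed.

(** If k is not adjacent to i, the previous step applies to the reversed walk, in
   which k takes the place of i1. *)
Lemma erasable_pair m i j y :
  walk m.*2.+1 i j -> content_of_two y i j -> erasable y.
Proof.
elim: m i j y => [|m IH] i j y.
  move=> /= [k ik <-] yik; have : ~~ adj i k; last by rewrite ik.
  by apply: (@buffer_nadj _ y); rewrite (perm_mem yik) !inE eqxx ?orbT.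
rewrite doubleS => -[i1 ii1 i1j] yij.
have [k [i2 i12 i2k] kj] := @walk_rconsP _ m.*2.+1 _ _ i1j.
case: (boolP (adj k i)) => ki.
  by apply: (erasable_pair_step IH yij ii1 i12 i2k kj); right.
have [k2 kk2 k2i1] : walk m.*2.+1 k i1 by apply: walk_sym; exists i2.
apply: (@erasable_pair_step m j i k k2 i1 y IH) => //; last by left.
- by apply: perm_trans yij _; apply/seq.permP => p /=; lia.
- by rewrite adj_sym.
- by rewrite adj_sym.
Qed.

(** Erase the last two letters; by sub-additivity the content has then lost at
   least two letters, whatever the erasing word did to the others. *)
Lemma even_erasable (sub_add : sub_additive phi)
    (odd_walk : forall i j : G, exists m, walk m.*2.+1 i j) y :
  even_buffer y -> erasable y.
Proof.
have [n] := ubnP (buffer_size y); elim: n y => // n IH y yn ey.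
have [y0|y0] := eqVneq (buffer_size y) 0%N.
  rewrite (_ : y = buffer0 G); first exact: erasable0.
  by apply/eqP; rewrite buffer_eq0 y0.
have [w [i [j yE]]] : exists w i j, sval y = w ++ [:: i; j].
  move: ey y0; rewrite /even_buffer /buffer_size.
  case/lastP: (sval y) => // s j; case/lastP: s => // s i _ _.
  by exists s, i, j; rewrite -!cats1 -catA.
have sub_adm (v : seq G) : {subset v <= sval y} -> admissible_word v.
  by move=> vy; apply/admissible_wordP => p q /vy py /vy; exact: buffer_nadj.
have aw : admissible_word w by apply: sub_adm => v; rewrite yE mem_cat => ->.
have aij : admissible_word [:: i; j].
  by apply: sub_adm => v; rewrite yE mem_cat => ->; rewrite orbT.
pose x : buffer G := exist _ w aw; pose yij : buffer G := exist _ [:: i; j] aij.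
have [m ij] := odd_walk i j.
have [z [dz z0 zij]] : erasable yij by apply: erasable_pair ij _; exact: perm_refl.
have lt_n : (buffer_size (run phi y z) < n)%N.
  have := run_sub_additive_suffix (x' := x) (y := yij) sub_add yE erefl dz.
  rewrite zij; move: yn; rewrite /buffer_size yE size_cat /=; lia.
have [|z' [dz' z'0 z'y]] := IH _ lt_n; first by rewrite run_even.
exists (z ++ z'); split; last by rewrite run_cat.
  by rewrite /drawable_arrivals all_cat; apply/andP.
by rewrite run_cat z0.
Qed.

End Erasing.

(** * Finite-horizon probabilities *)

Section FiniteHorizon.
Context (R : realType) (G : graph) (phi : policy R G) (mu : G -> R).
Hypothesis mu_distribution : is_distribution mu.
Hypothesis mu_full_support : forall v, 0 < mu v.
Implicit Types (x y : buffer G) (a b : arrivals G) (z : seq (arrivals G)).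

Notation p := (arrivals_law mu (nu phi)).

Lemma law_ge0 a : 0 <= p a.
Proof.
have [nu_ge0 _] := nu_distribution phi; have [mu_ge0 _] := mu_distribution.
by rewrite /arrivals_law !mulr_ge0.
Qed.

Lemma law_gt0 a : (0 < p a) = drawable_arrival phi a.
Proof.
have [nu_ge0 _] := nu_distribution phi.
rewrite /arrivals_law /drawable_arrival !lt0r !mulf_eq0 !negb_or !nu_ge0 !andbT.
by rewrite !(gt_eqF (mu_full_support _)) /= law_ge0 andbT.
Qed.

(** The two single arrivals of a pair are independent. *)
Lemma sum_law (f g : G -> R) :
  \sum_a p a * (f a.1.1 * g a.2.1) =
  (\sum_v mu v * f v) * (\sum_v mu v * g v).
Proof.
have [_ nu1] := nu_distribution phi.
have marginal (h : G -> R) :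
    \sum_(c : G * prefs G) mu c.1 * nu phi c.2 * h c.1 = \sum_v mu v * h v.
  rewrite -(pair_bigA _ (fun v s => mu v * nu phi s * h v)) /=.
  apply: eq_bigr => v _; rewrite -[RHS]mulr1 -nu1 mulr_sumr.
  by apply: eq_bigr => s _; ring.
rewrite -!marginal mulr_suml.
rewrite -(pair_bigA _ (fun c d : G * prefs G => mu c.1 * nu phi c.2 *
  (mu d.1 * nu phi d.2) * (f c.1 * g d.1))) /=.
by apply: eq_bigr => c _; rewrite mulr_sumr; apply: eq_bigr => d _; ring.
Qed.

Lemma law_sum1 : \sum_a p a = 1.
Proof.
have [_ mu1] := mu_distribution.
have := sum_law (fun=> 1) (fun=> 1).
under eq_bigr do rewrite !mulr1.
by under [in RHS]eq_bigr do rewrite mulr1; rewrite mu1 mulr1.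
Qed.

Lemma law_cst (c : R) : \sum_a p a * c = c.
Proof. by rewrite -mulr_suml law_sum1 mul1r. Qed.

Lemma ler_law_sum (f g : arrivals G -> R) :
  (forall a, drawable_arrival phi a -> f a <= g a) ->
  \sum_a p a * f a <= \sum_a p a * g a.
Proof.
move=> fg; apply: ler_sum => a _.
have := law_ge0 a; rewrite le_eqVlt => /predU1P[<-|]; first by rewrite !mul0r.
by move=> pa; rewrite ler_pM2l // fg // -law_gt0.
Qed.

(** The probability that the next n arrivals form a word satisfying Q. *)
Fixpoint prob n (Q : pred (seq (arrivals G))) : R :=
  if n is m.+1 then \sum_a p a * prob m (fun z => Q (a :: z)) else (Q [::])%:R.

Lemma prob_ge0 n Q : 0 <= prob n Q.
Proof.
elim: n Q => [|n IH] Q /=; first exact: ler0n.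
by apply: sumr_ge0 => a _; rewrite mulr_ge0 ?law_ge0.
Qed.

Lemma eq_prob n Q Q' : (forall z, Q z = Q' z) -> prob n Q = prob n Q'.
Proof. by move=> QQ'; congr prob; apply/funext. Qed.

Lemma prob_false n Q : (forall z, ~~ Q z) -> prob n Q = 0.
Proof.
elim: n Q => [|n IH] Q HQ /=; first by rewrite (negbTE (HQ _)).
by rewrite big1 // => a _; rewrite IH ?mulr0.
Qed.

Definition discrepancy n x y : R :=
  prob n (fun z => run phi x z != run phi y z).

Fixpoint avoids_empty x z : bool :=
  (x != buffer0 G) && (if z is a :: z' then avoids_empty (pair_step phi x a) z'
                       else true).

(** Time 0 counts, so that the survival probabilities sum up to the mean hitting
   time of the empty content, which is 0 from the empty content itself. *)
Definition survival n x : R := prob n (avoids_empty x).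

Lemma survival_ge0 n x : 0 <= survival n x.
Proof. exact: prob_ge0. Qed.

Lemma survival0 n : survival n (buffer0 G) = 0.
Proof. by apply: prob_false => -[|a z]; rewrite /= ?eqxx. Qed.

Lemma survivalS n x : x != buffer0 G ->
  survival n.+1 x = \sum_a p a * survival n (pair_step phi x a).
Proof.
move=> x0; apply: eq_bigr => a _; congr (_ * _).
by apply: eq_prob => z /=; rewrite x0.
Qed.

Lemma discrepancy_refl n x : discrepancy n x x = 0.
Proof. by apply: prob_false => z; rewrite eqxx. Qed.

(** The expectations of the coalescence time and of the hitting time of the
   empty content, both truncated at n. *)
Definition coalescence n x y : R := \sum_(k < n) discrepancy k x y.
Definition hitting n x : R := \sum_(k < n) survival k x.

Lemma coalescenceS n x y : coalescence n.+1 x y =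
  (x != y)%:R + \sum_a p a * coalescence n (pair_step phi x a) (pair_step phi y a).
Proof.
rewrite /coalescence big_ord_recl; congr (_ + _).
by under [RHS]eq_bigr do rewrite mulr_sumr; rewrite [RHS]exchange_big.
Qed.

Lemma hittingS n x : x != buffer0 G ->
  hitting n.+1 x = 1 + \sum_a p a * hitting n (pair_step phi x a).
Proof.
move=> x0; rewrite /hitting big_ord_recl; congr (_ + _).
  by rewrite /survival /= x0.
under [RHS]eq_bigr do rewrite mulr_sumr; rewrite [RHS]exchange_big.
by apply: eq_bigr => k _; rewrite lift0 survivalS.
Qed.

Lemma hitting_ge0 n x : 0 <= hitting n x.
Proof. by apply: sumr_ge0 => k _; exact: survival_ge0. Qed.

(** The mean hitting time of the empty content is finite. *)
Definition positive_recurrent :=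
  forall x, even_buffer x -> exists H : R, forall n, hitting n x <= H.

(** * Bipartite graphs are not positive recurrent *)

Section Charge.
Context (c : G -> bool).
Hypothesis c_col : two_colouring c.

Let sign v : R := if c v then 1 else -1.
Let charge x : R := \sum_(v <- sval x) sign v.

Let charge_odot x (b : G * prefs G) : charge (odot phi x b) = charge x + sign b.1.
Proof.
rewrite /charge; case: (odot_cases phi x b) => [->|[u bu xu]].
  by rewrite big_rcons.
rewrite (perm_big _ xu) /= big_cons.
by have := c_col bu; rewrite /sign; case: (c u); case: (c b.1) => //= _; ring.
Qed.

Let charge_le x : charge x <= (buffer_size x)%:R.
Proof.
rewrite /charge /buffer_size; elim: (sval x) => [|v w IH]; first by rewrite big_nil.
rewrite big_cons /= -add1n natrD lerD //.
by rewrite /sign; case: (c v) => //; lra.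
Qed.

Let sum_sign_l : \sum_a p a * sign a.1.1 = \sum_v mu v * sign v.
Proof.
have [_ mu1] := mu_distribution.
under eq_bigr do rewrite -[sign _]mulr1; rewrite (sum_law sign (fun=> 1)).
by under [X in _ * X]eq_bigr do rewrite mulr1; rewrite mu1 mulr1.
Qed.

Let sum_sign_r : \sum_a p a * sign a.2.1 = \sum_v mu v * sign v.
Proof.
have [_ mu1] := mu_distribution.
under eq_bigr do rewrite -[sign _]mul1r; rewrite (sum_law (fun=> 1) sign).
by under [X in X * _]eq_bigr do rewrite mulr1; rewrite mu1 mul1r.
Qed.

(** An arrival adds its sign to the charge whether it is stored or removes an
   item of the other colour. With a nonnegative drift the charge, stopped when
   the content is empty, is thus a submartingale; it vanishes when stopped and
   is at most the size, which grows by at most 2 at each step. *)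
Let charge_survival n x : 0 <= \sum_v mu v * sign v ->
  charge x <= (buffer_size x + 2 * n)%:R * survival n x.
Proof.
move=> drift; elim: n x => [|n IH] x.
  rewrite /survival /= muln0 addn0 andbT; case: eqVneq => [->|_].
    by rewrite /charge big_nil mulr0.
  by rewrite mulr1 charge_le.
have [->|x0] := eqVneq x (buffer0 G).
  by rewrite survival0 /charge big_nil mulr0.
have le_mean : charge x <= \sum_a p a * charge (pair_step phi x a).
  under eq_bigr do rewrite /pair_step !charge_odot !mulrDr.
  rewrite !big_split /= law_cst sum_sign_l sum_sign_r; lra.
apply: (le_trans le_mean); rewrite survivalS // mulr_sumr.
under [leRHS]eq_bigr do rewrite mulrCA.
apply: ler_law_sum => a _; apply: (le_trans (IH _)).
apply: ler_wpM2r; first exact: survival_ge0.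
by rewrite ler_nat; have := pair_step_size phi x a; lia.
Qed.

(** Two items of one class, of the colour that counts positively, make a charge
   of 2, so that the survival probability at time n is at least 1 / (n + 1),
   whose sum diverges. *)
Lemma positive_charge_not_recurrent :
  0 <= \sum_v mu v * sign v -> ~ positive_recurrent.
Proof.
move=> drift rec.
have [i ci] : exists i, c i.
  apply/existsP; apply: contraT => /existsPn nc.
  have [_ mu1] := mu_distribution; move: drift; rewrite leNgt => /negP[].
  rewrite (eq_bigr (fun v => mu v * -1)).
    by rewrite -mulr_suml mu1 mul1r ltrN10.
  by move=> v _; rewrite /sign (negbTE (nc v)).
have aii : admissible_word [:: i; i].
  by apply/admissible_wordP => u v; rewrite !inE !orbb => /eqP -> /eqP ->; rewrite adj_irr.
pose x : buffer G := exist _ [:: i; i] aii.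
have [H xH] := rec x isT.
apply: (@dvg_harmonic R); apply: nondecreasing_is_cvgn.
  apply/nondecreasing_seqP => n; rewrite !seriesEnat /= big_nat_recr //=.
  by rewrite lerDl invr_ge0 ler0n.
exists H => _ [n _ <-]; apply: le_trans (xH n).
rewrite seriesEord; apply: ler_sum => k _.
rewrite /harmonic /= -div1r ler_pdivrMr ?ltr0n //.
have := charge_survival k x drift.
rewrite /charge /= !big_cons big_nil /sign ci /buffer_size /= => le2.
have : 2 <= (2 * (k.+1)%:R) * survival k x.
  apply: le_trans (le_trans le2 _); first by rewrite addr0.
  by apply: ler_wpM2r; [exact: survival_ge0|rewrite -natrM ler_nat; lia].
lra.
Qed.

End Charge.

Lemma recurrent_odd_walk : positive_recurrent ->
  forall i j : G, exists m, walk m.*2.+1 i j.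
Proof.
move=> rec; case: (odd_walk_or_two_colouring G) => // -[c c_col].
pose drift (d : G -> bool) : R := \sum_v mu v * (if d v then 1 else -1).
have [dge0|dlt0] := leP 0 (drift c).
  by have := positive_charge_not_recurrent c_col dge0.
have nc_col : two_colouring (fun v => ~~ c v) by move=> i j /c_col ->.
suff : 0 <= \sum_v mu v * (if ~~ c v then 1 else -1).
  by move=> dge0; have := positive_charge_not_recurrent nc_col dge0.
have -> : \sum_v mu v * (if ~~ c v then 1 else -1) = - drift c.
  rewrite -sumrN; apply: eq_bigr => v _.
  by case: (c v) => /=; rewrite ?mulrN1 ?mulr1 ?opprK.
by rewrite oppr_ge0 ltW.
Qed.

End FiniteHorizon.

(** * Integrable coalescence times *)

Lemma finite_small_buffers (G : graph) (m : nat) : exists L : seq (buffer G),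
  forall x : buffer G, (buffer_size x <= m)%N -> x \in L.
Proof.
pose words :=
  flatten [seq [seq val t | t <- enum {: k.-tuple G}] | k <- iota 0 m.+1].
exists (pmap insub words) => x xm; rewrite mem_pmap_sub.
apply/flatten_mapP; exists (buffer_size x); first by rewrite mem_iota.
by apply/mapP; exists (in_tuple (sval x)) => //; rewrite mem_enum.
Qed.

Lemma seq_ub (R : realType) (T : eqType) (L : seq T) (F : T -> R) :
  exists2 B, 0 <= B & {in L, forall x, F x <= B}.
Proof.
elim: L => [|x L [B B0 HB]]; first by exists 0.
exists (`|F x| + B) => [|y]; first by rewrite addr_ge0.
rewrite inE => /predU1P[->|/HB yB]; have := ler_norm (F x).
  lra.
by have := normr_ge0 (F x); lra.
Qed.

Section CoalescenceTime.
Context (R : realType) (G : graph) (phi : policy R G) (mu : G -> R).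
Hypothesis mu_distribution : is_distribution mu.
Hypothesis mu_full_support : forall v, 0 < mu v.
Hypothesis sub_add : sub_additive phi.
Hypothesis rec : positive_recurrent phi mu.
Implicit Types (x y : buffer G) (a b : arrivals G) (z : seq (arrivals G)).

Notation p := (arrivals_law mu (nu phi)).
Notation e := (buffer0 G).
Notation coal := (coalescence phi mu).

(** The relation between two contents, fed by the same arrivals, that
   sub-additivity provides when the first is empty and the second has size at
   most m; it persists, and so bounds the second content by m whenever the
   first one is empty again. *)
Definition exceeds_by_at_most m x y := forall z, drawable_arrivals phi z ->
  (buffer_size (run phi y z) <= m + buffer_size (run phi x z))%N.

Lemma exceeds_step m x y a : drawable_arrival phi a ->
  exceeds_by_at_most m x y ->
  exceeds_by_at_most m (pair_step phi x a) (pair_step phi y a).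
Proof.
by move=> da H z dz; apply: (H (a :: z)); rewrite /drawable_arrivals /= da.
Qed.

Lemma exceeds_empty m y : (buffer_size y <= m)%N -> exceeds_by_at_most m e y.
Proof.
move=> ym z dz; apply: leq_trans (run_sub_additive sub_add y dz) _.
by rewrite leq_add2r.
Qed.

Definition coal_empty_bound m n (C : R) := forall k, (k < n)%N ->
  forall y, even_buffer y -> (buffer_size y <= m)%N -> coal k e y <= C.

Lemma coal_empty_boundW m n n' C : (n' <= n)%N ->
  coal_empty_bound m n C -> coal_empty_bound m n' C.
Proof. by move=> nn' H k kn'; apply: H; exact: leq_trans nn'. Qed.

Lemma coal0 x y : coal 0 x y = 0.
Proof. by rewrite /coalescence big_ord0. Qed.

Lemma coal_refl n x : coal n x x = 0.
Proof. by rewrite /coalescence big1 // => k _; rewrite discrepancy_refl. Qed.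

(** Until the first content is empty the time is counted in full; from then on
   the second has size at most m, so that the bound C applies. *)
Lemma coal_le_hitting m n x y C : even_buffer x -> even_buffer y ->
  exceeds_by_at_most m x y -> coal_empty_bound m n.+1 C ->
  coal n x y <= hitting phi mu n x + C.
Proof.
elim: n x y => [|n IH] x y ex ey xy HC.
  by rewrite coal0 /hitting big_ord0 add0r -(coal0 e e); apply: HC.
have [xe|x0] := eqVneq x e.
  rewrite xe; apply: ler_wpDl; first exact: hitting_ge0.
  by apply: HC => //; have := xy [::] isT; rewrite xe /= addn0.
rewrite coalescenceS hittingS // -addrA lerD //.
  by case: (x == y); rewrite ?ler01.
rewrite -[X in _ <= _ + X](law_cst phi mu_distribution) -big_split /=.
under [leRHS]eq_bigr do rewrite -mulrDr.
apply: (ler_law_sum mu_distribution mu_full_support) => a da.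
apply: IH; rewrite ?pair_step_even //; first exact: exceeds_step.
exact: coal_empty_boundW HC.
Qed.

(** If the next arrivals follow the given word, the contents merge; if not,
   wait until the first content is empty again. *)
Lemma coal_le_word m z x y : drawable_arrivals phi z ->
  even_buffer x -> even_buffer y -> exceeds_by_at_most m x y ->
  run phi x z = run phi y z ->
  exists K w : R, [/\ 0 <= K, 0 < w & forall n C, 0 <= C ->
    coal_empty_bound m n C -> coal n x y <= K + (1 - w) * C].
Proof.
elim: z x y => [|a z IH] x y.
  move=> _ _ _ _ /= ->; exists 0, 1; split=> // n C C0 _.
  by rewrite coal_refl subrr mul0r addr0.
move=> /andP[da dz] ex ey xy xyz.
have [||||K [w [K0 w0 Kw]]] := IH (pair_step phi x a) (pair_step phi y a) dz;
  rewrite ?pair_step_even //; first exact: exceeds_step.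
have hitH b : exists h, forall n, hitting phi mu n (pair_step phi x b) <= h.
  by apply: rec; rewrite pair_step_even.
have [H HH] := boolp.choice hitH.
have pa : 0 < p a by rewrite law_gt0.
have p1 : p a <= 1.
  rewrite -(law_sum1 phi mu_distribution) (bigD1 a) //= lerDl.
  by apply: sumr_ge0 => b _; exact: law_ge0.
have H0 b : 0 <= H b := le_trans (hitting_ge0 _ _ 0 _) (HH b 0%N).
have S0 : 0 <= \sum_b H b by apply: sumr_ge0 => b _; exact: H0.
(* Capping w at 1 keeps the factor 1 - p a * w' of C nonnegative. *)
pose w' := Num.min w 1.
have w'0 : 0 < w' by rewrite lt_min w0 ltr01.
exists (1 + (K + \sum_b H b)), (p a * w'); split.
- by rewrite !addr_ge0.
- exact: mulr_gt0.
move=> [|n] C C0 HC.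
  rewrite coal0 addr_ge0 ?addr_ge0 // mulr_ge0 // subr_ge0.
  by apply: mulr_ile1; rewrite ?(ltW pa) ?(ltW w'0) // ge_min lexx orbT.
rewrite coalescenceS -addrA lerD //; first by case: (x == y); rewrite ?ler01.
have -> : K + \sum_b H b + (1 - p a * w') * C =
    \sum_b p b * (K + \sum_b H b + C - (b == a)%:R * (w' * C)).
  under [RHS]eq_bigr do rewrite mulrBr.
  rewrite sumrB (law_cst phi mu_distribution).
  have -> : \sum_b p b * ((b == a)%:R * (w' * C)) = p a * (w' * C).
    rewrite (bigD1 a) //= eqxx mul1r big1 ?addr0 // => b /negbTE ->.
    by rewrite mul0r mulr0.
  ring.
apply: (ler_law_sum mu_distribution mu_full_support) => b db.
have [->|ba] := eqVneq b a.
  have := Kw n C C0 (coal_empty_boundW (leqnSn n) HC).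
  have : w' * C <= w * C by rewrite ler_wpM2r // ge_min lexx.
  rewrite mul1r; lra.
have := coal_le_hitting (n := n) (C := C) (m := m) (x := pair_step phi x b)
  (y := pair_step phi y b).
rewrite !pair_step_even => /(_ ex ey (exceeds_step db xy) HC).
have := HH b n; have : H b <= \sum_b H b.
  by rewrite (bigD1 b) //= lerDl; apply: sumr_ge0 => c _; exact: H0.
rewrite mul0r subr0; lra.
Qed.

(** Each time the first content is empty, the second has size at most m, and an
   erasing word follows with a probability bounded below; otherwise the first is
   empty again after a time of bounded mean. The number of trials is geometric.
   The bound is proved for the truncated times, by induction on the truncation. *)
Lemma coal_bounded m : exists B : R, forall y n,
  even_buffer y -> (buffer_size y <= m)%N -> coal n e y <= B.
Proof.
have H y : exists Kw : R * R, even_buffer y -> (buffer_size y <= m)%N ->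
    [/\ 0 <= Kw.1, 0 < Kw.2 & forall n C, 0 <= C ->
      coal_empty_bound m n C -> coal n e y <= Kw.1 + (1 - Kw.2) * C].
  have [[ey ym]|ny] := pselect (even_buffer y /\ (buffer_size y <= m)%N); last first.
    by exists (0, 0) => ey ym; case: ny.
  have [z [dz z0 zy]] := even_erasable sub_add
    (recurrent_odd_walk mu_distribution mu_full_support rec) ey.
  have [||K [w Kw]] := coal_le_word dz _ ey (exceeds_empty ym); last by exists (K, w).
    by [].
  by rewrite z0 zy.
have [Kw HKw] := boolp.choice H.
(* The bound reproduces itself, K + (1 - w) * B <= B, as soon as K / w <= B. *)
have [L HL] := finite_small_buffers G m.
have [B B0 HB] := seq_ub L (fun y => (Kw y).1 / (Kw y).2).
exists B => y n; have [N] := ubnP n; elim: N n y => // N IH n y nN ey ym.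
have [K0 w0 Hn] := HKw y ey ym.
apply: (le_trans (Hn n B B0 _)).
  by move=> k kn y' ey' ym'; apply: IH => //; exact: leq_trans kn _.
have := HB y (HL y ym); rewrite ler_pdivrMr //; lra.
Qed.

End CoalescenceTime.

(** * The product measure *)

Section Windows.
Context (G : graph).
Implicit Types (w : Omega G) (k l : int) (n : nat).

Definition window k n w : seq (arrivals G) := mkseq (fun i => w (k + i%:Z)) n.

Lemma window_cons k n w : window k n.+1 w = w k :: window (k + 1) n w.
Proof.
rewrite /window /mkseq /= addr0 (iotaDl 1 0) -map_comp; congr cons.
by apply: eq_map => i /=; rewrite PoszD addrA.
Qed.

Lemma window_rcons k n w : window k n.+1 w = rcons (window k n w) (w (k + n%:Z)).
Proof. exact: mkseqS. Qed.

Lemma window_shift k n l w : window k n (shift l w) = window (k + l) n w.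
Proof. by apply: eq_map => i; rewrite /shift addrAC. Qed.

Lemma shift_add k l w : shift k (shift l w) = shift (k + l) w.
Proof. by apply/funext => i; rewrite /shift -addrA. Qed.

Lemma shift_zero w : shift 0 w = w.
Proof. by apply/funext => i; rewrite /shift addr0. Qed.

Lemma measurable_coordinate k (B : {set arrivals G}) :
  measurable [set w : Omega G | w k \in B].
Proof. by apply: sub_sigma_algebra; exists k, B. Qed.

Lemma measurable_rectangle (s : seq int) (B : int -> {set arrivals G}) :
  measurable [set w : Omega G | forall k, k \in s -> w k \in B k].
Proof.
elim: s => [|k s IH].
  by rewrite (_ : [set _ | _] = setT)//; apply/seteqP; split.
rewrite (_ : [set _ | _] = [set w : Omega G | w k \in B k] `&`
    [set w : Omega G | forall k, k \in s -> w k \in B k]).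
  by apply: measurableI => //; exact: measurable_coordinate.
apply/seteqP; split => w /=.
  by move=> H; split=> [|l ls]; apply: H; rewrite inE ?eqxx ?ls ?orbT.
by move=> [H Hs] l; rewrite inE => /predU1P[->//|]; exact: Hs.
Qed.

Lemma split_first (A : set (Omega G)) k :
  A = \bigcup_(a in [set: arrivals G])
    (A `&` [set w : Omega G | w k \in [set a]%SET]).
Proof.
apply/seteqP; split => w /=; last by move=> [a _ []].
by move=> Aw; exists (w k) => //=; rewrite inE.
Qed.

Lemma measurable_window (Q : pred (seq (arrivals G))) k n :
  measurable [set w : Omega G | Q (window k n w)].
Proof.
elim: n k Q => [|n IH] k Q.
  case: (boolP (Q [::])) => HQ.
    by rewrite (_ : [set _ | _] = setT)//; apply/seteqP; split.
  by rewrite (_ : [set _ | _] = set0)//; apply/seteqP; split => // w /=; exact/negP.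
rewrite [X in measurable X](split_first _ k).
apply: fin_bigcup_measurable => [|a _]; first exact: finite_finset.
rewrite (_ : _ `&` _ = [set w : Omega G | Q (a :: window (k + 1) n w)] `&`
  [set w : Omega G | w k \in [set a]%SET]).
  apply: measurableI; last exact: measurable_coordinate.
  exact: (IH _ (fun z => Q (a :: z))).
by apply/seteqP; split => w /=; rewrite window_cons inE => -[+ /eqP wk]; rewrite wk.
Qed.

Lemma measurable_shift k : measurable_fun setT (@shift G k).
Proof.
apply: (@measurability _ _ (Omega G) (Omega G) setT _ (@coordinate_sets G)) => //.
move=> _ [_ [n [B ->]] <-].
rewrite setTI; exact: (measurable_coordinate (n + k) B).
Qed.

HB.instance Definition _ k :=
  isMeasurableFun.Build _ _ _ _ (@shift G k) (measurable_shift k).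

End Windows.

Section ProductMeasure.
Context (R : realType) (G : graph) (phi : policy R G) (mu : G -> R).
Context (P : probability (Omega G) R).
Hypothesis mu_distribution : is_distribution mu.
Hypothesis P_product : is_product_measure mu (nu phi) P.

Notation p := (arrivals_law mu (nu phi)).

(** The rectangle records the arrivals that the induction on n has already
   fixed; each step adds the coordinate k to it. *)
Lemma rectangle_window_law (s : seq int) (B : int -> {set arrivals G})
    (Q : pred (seq (arrivals G))) (k : int) (n : nat) :
  uniq s -> {in s, forall l : int, l < k} ->
  P ([set w : Omega G | forall l, l \in s -> w l \in B l] `&`
     [set w : Omega G | Q (window k n w)]) =
  ((\prod_(l <- s) \sum_(a in B l) p a) * prob phi mu n Q)%:E.
Proof.
elim: n s B Q k => [|n IH] s B Q k us sk.
  rewrite /=; case: (boolP (Q [::])) => HQ.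
    rewrite mulr1 -P_product //; congr (P _).
    by apply/seteqP; split => w //= [].
  rewrite mulr0 -[RHS](measure0 P); congr (P _).
  by apply/seteqP; split => w //= [_]; apply/negP.
pose B' a l := if l == k then [set a]%SET else B l.
have ks : k \notin s by apply/negP => /sk; rewrite ltxx.
rewrite [X in P X](split_first _ k) measure_fin_bigcup; last 3 first.
- exact: finite_finset.
- move=> a b _ _ [w [[_ +] [_ +]]]; rewrite /= !inE => /eqP <- /eqP <- //.
- move=> a _; apply: measurableI; last exact: measurable_coordinate.
  by apply: measurableI; [exact: measurable_rectangle|exact: measurable_window].
rewrite (fsbigE (enum {: arrivals G})) ?enum_uniq //; last first.
  by move=> a _; rewrite mem_enum.
transitivity (\sum_a ((\prod_(l <- s) \sum_(b in B l) p b) *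
   (p a * prob phi mu n (fun z => Q (a :: z))))%:E)%E; last first.
  by rewrite sumEFin /= mulr_sumr.
rewrite big_enum_cond /=; apply: eq_big => [a|a _]; first by rewrite in_setT.
transitivity (P ([set w : Omega G | forall l, l \in k :: s -> w l \in B' a l] `&`
  [set w : Omega G | Q (a :: window (k + 1) n w)])).
  congr (P _); apply/seteqP; split => w /=.
    rewrite window_cons inE => -[[ws Qw] /eqP wk]; split; last by rewrite -wk.
    move=> l; rewrite /B' inE => /predU1P[->|ls]; first by rewrite eqxx inE wk.
    by case: eqVneq ls => [->|_ /ws//]; rewrite (negbTE ks).
  move=> [ws Qw].
  have wk : w k = a by have := ws k (mem_head _ _); rewrite /B' eqxx inE => /eqP.
  rewrite window_cons wk inE eqxx; split=> //; split=> // l ls.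
  have := ws l; rewrite inE ls orbT /B' => /(_ isT).
  by case: eqVneq ls => [->|//]; rewrite (negbTE ks).
rewrite (IH _ _ (fun z => Q (a :: z))) /= ?ks //; last first.
  move=> l; rewrite inE => /predU1P[->|/sk]; first by rewrite ltrDl.
  by move=> /lt_trans; apply; rewrite ltrDl.
rewrite big_cons /B' eqxx (big_set1 _ a) mulrA; congr ((_ * _)%:E).
rewrite mulrC; congr (_ * _); apply: eq_big_seq => l ls.
by case: eqVneq ls => [->|//]; rewrite (negbTE ks).
Qed.

Lemma window_law (Q : pred (seq (arrivals G))) (k : int) (n : nat) :
  P [set w : Omega G | Q (window k n w)] = (prob phi mu n Q)%:E.
Proof.
rewrite -[RHS]/((prob phi mu n Q)%:E) -[prob phi mu n Q in RHS]mul1r.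
have := @rectangle_window_law [::] (fun=> finset.set0) Q k n isT.
rewrite big_nil => <- //; congr (P _).
by apply/seteqP; split => w //= [].
Qed.

(** Rectangles form a pi-system on which P and its image under the shift
   agree. *)
Lemma shift_invariant (k : int) (A : set (Omega G)) : measurable A ->
  P (shift k @^-1` A) = P A.
Proof.
pose C := [set A : set (Omega G) | exists s (B : int -> {set arrivals G}),
  uniq s /\ A = [set w : Omega G | forall l, l \in s -> w l \in B l]].
move=> mA; rewrite -[LHS]/(distribution P (@shift G k) A).
apply: (measure_unique C (fun=> setT)) => //.
- apply/seteqP; split.
    apply: smallest_sub; first exact: smallest_sigma_algebra.
    move=> _ [n [B ->]]; apply: sub_sigma_algebra.
    exists [:: n], (fun=> B); split=> //; apply/seteqP; split => w /=.
      by move=> wB l; rewrite inE => /eqP ->.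
    by apply; rewrite mem_head.
  apply: smallest_sub; first exact: sigma_algebra_measurable.
  by move=> _ [s [B [_ ->]]]; exact: measurable_rectangle.
- move=> _ _ [s1 [B1 [_ ->]]] [s2 [B2 [_ ->]]].
  exists (undup (s1 ++ s2)), (fun l => ((if l \in s1 then B1 l else [set: arrivals G]) :&:
    (if l \in s2 then B2 l else [set: arrivals G]))%SET); split; first exact: undup_uniq.
  apply/seteqP; split => w /=.
    move=> [w1 w2] l _; rewrite inE; apply/andP; split.
      by case: ifP => [/w1//|_]; rewrite inE.
    by case: ifP => [/w2//|_]; rewrite inE.
  move=> H; split=> l ls; have := H l; rewrite mem_undup mem_cat ls ?orbT.
    by move=> /(_ isT); rewrite inE => /andP[].
  by move=> /(_ isT); rewrite inE => /andP[].
- by move=> _; exists [::], (fun=> finset.set0); split=> //; apply/seteqP; split.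
- by rewrite bigcup_const //; exists 0%N.
- move=> _ [s [B [us ->]]]; apply: (etrans _ (esym (P_product B us))).
  pose sk := [seq l + k | l <- s].
  have usk : uniq sk by rewrite map_inj_uniq //; exact: addIr.
  have := P_product (fun l => B (l - k)) usk.
  rewrite big_map; under eq_bigr do rewrite addrK.
  move=> <-; rewrite /distribution /pushforward /=.
  congr (P _); apply/seteqP; split => w /= H.
    by move=> _ /mapP[l ls ->]; rewrite addrK; exact: H.
  by move=> l ls; have := H (l + k); rewrite addrK; apply; exact: map_f.
- move=> _; apply: le_lt_trans (ltry 1).
  exact: (@probability_le1 _ _ _ P [set: Omega G]).
Qed.

End ProductMeasure.

(** * Backward coupling *)

Lemma seq_eventually (T : eqType) (L : seq T) (A : T -> nat -> Prop) :
  {in L, forall x, exists N, forall n, (N <= n)%N -> A x n} ->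
  exists N, {in L, forall x n, (N <= n)%N -> A x n}.
Proof.
elim: L => [|x L IH] H; first by exists 0%N.
have [|N1 H1] := IH; first by move=> y yL; apply: H; rewrite inE yL orbT.
have [N2 H2] := H x (mem_head _ _).
exists (maxn N1 N2) => y; rewrite inE => /predU1P[->|yL] n;
  rewrite geq_max => /andP[n1 n2].
  exact: H2.
exact: H1.
Qed.

Section Coupling.
Context (R : realType) (G : graph) (phi : policy R G) (mu : G -> R).
Context (P : probability (Omega G) R).
Hypothesis mu_distribution : is_distribution mu.
Hypothesis mu_full_support : forall v, 0 < mu v.
Hypothesis P_product : is_product_measure mu (nu phi) P.
Hypothesis sub_add : sub_additive phi.
Hypothesis h1 : H1 phi P.
Implicit Types (x y : buffer G) (w : Omega G).

Notation e := (buffer0 G).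

Lemma ae_shift k (Q : Omega G -> Prop) :
  {ae P, forall w, Q w} -> {ae P, forall w, Q (shift k w)}.
Proof.
move=> [A [mA A0 NA]]; exists (shift k @^-1` A); split.
- by rewrite -[X in measurable X]setTI; exact: measurable_shift.
- by rewrite (shift_invariant P_product).
- by move=> w Hw; exact: NA.
Qed.

Lemma U_run (Y : Omega G -> buffer G) n w :
  U_ phi Y n w = run phi (Y w) (window 0 n w).
Proof.
elim: n => [//|n IH]; rewrite window_rcons /run foldl_rcons -/(run _ _ _) -IH.
by rewrite /= /VS0 /VS1 /shift /pair_step.
Qed.

Definition backward x n w : buffer G := run phi x (window (- n%:Z) n w).

Lemma U_backward Y n w :
  U_ phi Y n (shift (- n%:Z) w) = backward (Y (shift (- n%:Z) w)) n w.
Proof. by rewrite U_run window_shift add0r. Qed.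

Lemma opp_succ_add1 (n : nat) : - n.+1%:Z + 1 = - n%:Z.
Proof. by rewrite -addn1 PoszD opprD addrNK. Qed.

Lemma backwardS x n w :
  backward x n.+1 w = backward (pair_step phi x (w (- n.+1%:Z))) n w.
Proof.
by rewrite /backward window_cons /= opp_succ_add1.
Qed.

Lemma backward_shift1 x n w :
  backward x n.+1 (shift 1 w) = pair_step phi (backward x n w) (w 0).
Proof.
rewrite /backward window_shift window_rcons /run foldl_rcons.
by rewrite opp_succ_add1 addNr.
Qed.

Lemma avoids_emptyP x z m : (m <= size z)%N -> avoids_empty phi x z ->
  run phi x (take m z) != e.
Proof.
by elim: m x z => [|m IH] x [|a z] //= mz /andP[x0 Hz]; rewrite ?x0 // IH.
Qed.

(** From a content that is not empty, the hitting time of the empty content is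
   the return time of the statement; from the empty one it is 0. *)
Lemma H1_positive_recurrent : positive_recurrent phi mu.
Proof.
move=> x ex; pose Y : {mfun Omega G >-> buffer G} := cst x.
have Yinf : Y2inf Y.
  exists (buffer_size x).+1 => // w /=; rewrite /buffer_le /= ex /=; lia.
have tau_int := h1 Yinf; have tau_fin := integrable_fin_num measurableT tau_int.
exists (fine (\int[P]_w tau1 phi Y w)) => n.
pose A k := [set w : Omega G | avoids_empty phi x (window 0 k w)].
have mA k : measurable (A k) by exact: measurable_window.
rewrite -lee_fin fineK //.
have -> : ((hitting phi mu n x)%:E = \int[P]_w \sum_(k < n) (\1_(A k) w)%:E)%E.
  rewrite ge0_integral_sum //; last first.
    by move=> k; apply/measurable_EFinP; exact: measurable_indic.
  rewrite /hitting -sumEFin; apply: eq_bigr => k _.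
  rewrite integral_indic // setIT.
  exact: (esym (window_law P_product (avoids_empty phi x) 0 k)).
apply: ge0_le_integral => //.
- by move=> w _; apply: sume_ge0 => k _; rewrite lee_fin.
- by apply: emeasurable_sum => k; apply/measurable_EFinP; exact: measurable_indic.
- exact: measurable_int tau_int.
move=> w _; apply: le_ereal_inf_tmp => _ [m [_ Um] <-].
rewrite sumEFin lee_fin.
(* Once the content has been empty at time m, A k fails for all k >= m. *)
apply: (@le_trans _ _ (\sum_(k < n) (k < m)%:R)).
  apply: ler_sum => k _; rewrite indicE; case: (ltnP k m) => km.
    by case: (w \in A k).
  rewrite memNset //= => /(avoids_emptyP (m := m)).
  rewrite size_mkseq => /(_ km) /eqP; apply.
  move: Um; rewrite U_run => <-; congr run.
  by rewrite /window /mkseq -map_take take_iota (minn_idPl km).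
rewrite -natr_sum ler_nat.
suff -> : (\sum_(k < n) (k < m) = minn n m)%N by rewrite geq_minr.
by elim: n => [|n IH]; rewrite ?big_ord0 ?min0n // big_ord_recr /= IH; lia.
Qed.

Definition coalescing w := forall x, even_buffer x ->
  exists N, forall n, (N <= n)%N -> backward x n w = backward e n w.

(** Borel-Cantelli: the probabilities that the contents started from x and
   from the empty one at time - n still differ at time 0 sum up to the mean
   coalescence time. *)
Lemma ae_coalescing : {ae P, forall w, coalescing w}.
Proof.
have one x : even_buffer x -> {ae P, forall w, exists N, forall n, (N <= n)%N ->
    backward x n w = backward e n w}.
  move=> ex.
  pose F n := [set w | backward e n w != backward x n w].
  have mF n : measurable (F n).
    exact: (measurable_window (fun z => run phi e z != run phi x z)).
  have PF n : P (F n) = (discrepancy phi mu n e x)%:E.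
    exact: (window_law P_product
      (fun z => run phi e z != run phi x z)).
  have [B HB] := coal_bounded mu_distribution mu_full_support sub_add
    H1_positive_recurrent (buffer_size x).
  have limF : P (lim_sup_set F) = 0%E.
    apply: lim_sup_set_cvg0 => //; apply: le_lt_trans (ltry B).
    apply: lime_le; first by apply: is_cvg_nneseries => n _ _; exact: measure_ge0.
    apply: nearW => n.
    rewrite (eq_bigr (fun k => (discrepancy phi mu k e x)%:E)); last first.
      by move=> k _; exact: PF.
    by rewrite sumEFin lee_fin big_mkord; exact: HB.
  exists (lim_sup_set F); split => //.
    by apply: bigcap_measurable => // k _; exact: bigcup_measurable.
  move=> w /= nw n _; apply: contrapT => Hn; apply: nw.
  exists n => m nm; apply/eqP; rewrite eq_sym; apply: contrapT => /negP Fm.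
  by apply: Hn; exists m.
have all_n : {ae P, forall w, forall i : nat, if @unpickle (buffer G) i is Some x
    then even_buffer x -> exists N, forall n, (N <= n)%N ->
      backward x n w = backward e n w else True}.
  apply: ae_foralln => i; case: (unpickle i) => [x|]; last exact: aeW.
  by case: (boolP (even_buffer x)) => [/one|_];
    [apply: filterS => w H _; exact: H|exact: aeW].
apply: filterS all_n => w H x; have := H (pickle x); by rewrite pickleK.
Qed.

Lemma coalescing_uniform w m : coalescing w -> exists N, forall x n,
  even_buffer x -> (buffer_size x <= m)%N -> (N <= n)%N ->
  backward x n w = backward e n w.
Proof.
move=> Hw; have [L HL] := finite_small_buffers G m.
have [|N HN] := @seq_eventually _ L
  (fun x n => even_buffer x -> backward x n w = backward e n w).
  move=> x _; case: (boolP (even_buffer x)) => [/Hw[N HN]|]; last by exists 0%N.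
  by exists N => n /HN.
by exists N => x n ex /HL xL Nn; exact: HN.
Qed.

Definition ultimately_at w y :=
  exists N, forall n, (N <= n)%N -> backward e n w = y.

Lemma ultimately_at_uniq w y y' : ultimately_at w y -> ultimately_at w y' -> y = y'.
Proof.
by move=> [N HN] [N' HN']; rewrite -(HN _ (leq_maxl N N')) (HN' _ (leq_maxr N N')).
Qed.

(** Starting at time - n - 1 instead of - n replaces the empty content at time
   - n by a content of size at most 2. *)
Lemma coalescing_ultimately w : coalescing w -> exists y, ultimately_at w y.
Proof.
move=> /(coalescing_uniform 2)[N HN]; exists (backward e N w), N => n.
elim: n => [|n IH]; first by rewrite leqn0 => /eqP ->.
rewrite leq_eqVlt => /predU1P[->//|]; rewrite ltnS => Nn; rewrite -(IH Nn) backwardS.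
by apply: HN => //; rewrite ?pair_step_even //; exact: pair_step_size.
Qed.

Definition limit_content w : buffer G := xget e (ultimately_at w).

Lemma limit_contentP w : coalescing w -> ultimately_at w (limit_content w).
Proof. by move=> /coalescing_ultimately; exact: xgetPex. Qed.

Lemma limit_content_even w : even_buffer (limit_content w).
Proof.
rewrite /limit_content; case: xgetP => [y _ [N /(_ N (leqnn N)) <-]|_].
  by rewrite /backward run_even.
by [].
Qed.

Lemma measurable_limit_content : measurable_fun setT limit_content.
Proof.
have mult y : measurable [set w | ultimately_at w y].
  rewrite (_ : [set _ | _] = \bigcup_N \bigcap_(n in [set n | (N <= n)%N])
      [set w | backward e n w == y]).
    apply: bigcupT_measurable => N.
    apply: bigcap_measurable => [|n _]; first by exists N => /=.
    exact: (measurable_window (fun z => run phi e z == y)).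
  apply/seteqP; split => w /=.
    by move=> [N HN]; exists N => // n /= Nn; apply/eqP; exact: HN.
  by move=> [N _ HN]; exists N => n Nn; apply/eqP; exact: HN.
have mcup : measurable (\bigcup_y [set w | ultimately_at w y]).
  exact: countable_bigcupT_measurable.
move=> _ B _; rewrite setTI.
(* Where there is no ultimate value, the limit is the empty content. *)
rewrite (_ : _ @^-1` B = \bigcup_y (if y \in B then
    if y == e then [set w | ultimately_at w y] `|`
                   ~` \bigcup_y [set w | ultimately_at w y]
    else [set w | ultimately_at w y] else set0)).
  apply: (@countable_bigcupT_measurable _ _ (buffer G)) => [|y].
    exact: (@countableP (buffer G)).
  case: ifP => // _; case: ifP => // _.
  by apply: measurableU => //; exact: measurableC.
apply/seteqP; split => w /=.
  move=> Bw; exists (limit_content w) => //; rewrite mem_set //.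
  move: Bw; rewrite /limit_content; case: xgetP => [y _ uy _|nu _].
    by case: ifP => // _; left.
  by rewrite eqxx; right => -[y _ uy]; exact: (nu y).
have limE y : ultimately_at w y -> limit_content w = y.
  by move=> uy; apply: xget_subset1 => // y1 y2; exact: ultimately_at_uniq.
move=> [y _]; case: ifP => // /set_mem yB; case: ifP => [/eqP ye|_ /limE -> //].
case=> [/limE -> //|nw]; rewrite /limit_content xgetPN -?ye // => y' uy'.
by apply: nw; exists y'.
Qed.

HB.instance Definition _ := isMeasurableFun.Build _ _ _ _
  limit_content measurable_limit_content.

Lemma limit_content_solution : is_solution phi P limit_content.
Proof.
have cs := ae_shift 1 ae_coalescing.
apply: filterS2 ae_coalescing cs => w /limit_contentP[N HN] /limit_contentP[N' HN'].
have := HN' (maxn N N').+1; rewrite backward_shift1 => <-.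
  by rewrite HN ?leq_maxl.
exact: leq_trans (leq_maxr _ _) (leqnSn _).
Qed.

Lemma limit_content_coupling (Y : {mfun Omega G >-> buffer G}) : Y2inf Y ->
  strong_backwards_coupling phi P Y limit_content.
Proof.
move=> [r _ Yr]; apply: filterS ae_coalescing => w cw.
have [N1 HN1] := limit_contentP cw.
have [N2 HN2] := coalescing_uniform (2 * r) cw.
exists (maxn N1 N2) => n; rewrite geq_max => /andP[n1 n2].
rewrite U_backward; have /andP[Ye Ys] := Yr (shift (- n%:Z) w).
by rewrite HN2 ?HN1.
Qed.

Lemma solution_backward (U : Omega G -> buffer G) : is_solution phi P U ->
  {ae P, forall w, forall n, U w = backward (U (shift (- n%:Z) w)) n w}.
Proof.
move=> solU.
have : {ae P, forall w, forall n : nat,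
    U (shift 1 (shift (- n.+1%:Z) w)) =
    pair_step phi (U (shift (- n.+1%:Z) w)) (w (- n.+1%:Z))}.
  apply: ae_foralln => n; have := ae_shift (- n.+1%:Z) solU.
  by apply: filterS => w ->; rewrite /VS0 /VS1 /shift /= add0r.
apply: filterS => w H n; elim: n => [|n IH]; first by rewrite oppr0 shift_zero.
by rewrite IH backwardS -H shift_add addrC opp_succ_add1.
Qed.

Lemma discrepancy_cvg0 y : even_buffer y ->
  discrepancy phi mu n e y @[n --> \oo] --> (0 : R).
Proof.
move=> ey; have [B HB] := coal_bounded mu_distribution mu_full_support sub_add
    H1_positive_recurrent (buffer_size y).
apply: cvg_series_cvg_0; apply: nondecreasing_is_cvgn.
  apply/nondecreasing_seqP => n; rewrite !seriesEnat /= big_nat_recr //=.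
  by rewrite lerDl; exact: prob_ge0.
by exists B => _ [n _ <-]; rewrite seriesEord; exact: HB.
Qed.

Lemma sum_discrepancy_cvg0 (L : seq (buffer G)) :
  \sum_(y <- L | even_buffer y) discrepancy phi mu n e y @[n --> \oo] --> (0 : R).
Proof.
elim: L => [|y L IH]; first by under eq_fun do rewrite big_nil; exact: cvg_cst.
under eq_fun do rewrite big_cons; have [ey|ney] := boolP (even_buffer y); last exact: IH.
have H := cvgD (discrepancy_cvg0 ey) IH; rewrite addr0 in H; exact: H.
Qed.

Lemma prob_has n (L : seq (buffer G)) (Q : buffer G -> pred (seq (arrivals G))) :
  prob phi mu n (fun z => has (Q^~ z) L) <= \sum_(y <- L) prob phi mu n (Q y).
Proof.
elim: n Q => [|n IH] Q /=.
  elim: L => [|y L IHL]; first by rewrite big_nil.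
  rewrite big_cons /=; apply: (@le_trans _ _ ((Q y [::])%:R + (has (Q^~ [::]) L)%:R)).
    by case: (Q y [::]) (has _ _) => [] [] //=; lra.
  by rewrite lerD2l.
rewrite exchange_big; apply: ler_sum => a _; rewrite -mulr_sumr.
by apply: ler_wpM2l; [exact: law_ge0|exact: (IH (fun y z => Q y (a :: z)))].
Qed.

Lemma measurable_large (U : {mfun Omega G >-> buffer G}) (m : nat) :
  measurable [set w | (m < buffer_size (U w))%N].
Proof.
rewrite -[X in measurable X]setTI.
exact: (measurable_funPT U measurableT [set x | (m < buffer_size x)%N]).
Qed.

Lemma large_cvg0 (U : {mfun Omega G >-> buffer G}) :
  P [set w | (m < buffer_size (U w))%N] @[m --> \oo] --> (0 : \bar R)%E.
Proof.
have I0 : \bigcap_m [set w | (m < buffer_size (U w))%N] = set0.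
  by apply/seteqP; split => // w /(_ (buffer_size (U w)) Logic.I) /=; rewrite ltnn.
rewrite -(measure0 P) -I0; apply: nonincreasing_cvg_mu.
- by apply: le_lt_trans (ltry 1); exact: probability_le1 (measurable_large U 0).
- exact: measurable_large.
- by rewrite I0; exact: measurable0.
- by move=> m n mn; apply/subsetPset => w /=; exact: leq_ltn_trans.
Qed.

Lemma measurable_neq (U V : {mfun Omega G >-> buffer G}) :
  measurable [set w | U w <> V w].
Proof.
rewrite (_ : [set _ | _] = \bigcup_x (U @^-1` [set x] `&` V @^-1` [set~ x])).
  apply: (@countable_bigcupT_measurable _ _ (buffer G)) => [|x].
    exact: (@countableP (buffer G)).
  by apply: measurableI; rewrite -[X in measurable X]setTI; exact: measurable_funPT.
apply/seteqP; split => w /=; first by move=> UV; exists (U w) => //=; split => // /esym.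
by move=> [x _ [<- /= VU]] UV; apply: VU.
Qed.

(** Solutions are stationary, so they exceed m at time - n with the same
   probability as at time 0. If two solutions are at most m at time - n and
   differ at time 0, then one of them has not coalesced with the empty content
   started at time - n. *)
Lemma solutions_differ_le (U V : {mfun Omega G >-> buffer G}) m
    (L : seq (buffer G)) n : Y2rv U -> Y2rv V ->
  is_solution phi P U -> is_solution phi P V ->
  (forall x, (buffer_size x <= m)%N -> x \in L) ->
  (P [set w | U w <> V w] <= P [set w | (m < buffer_size (U w))%N] +
    P [set w | (m < buffer_size (V w))%N] +
    (\sum_(y <- L | even_buffer y) discrepancy phi mu n e y)%:E)%E.
Proof.
move=> eU eV /solution_backward [A [mA A0 HA]] /solution_backward [B [mB B0 HB]] HL.
pose Q y z := even_buffer y && (run phi e z != run phi y z).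
pose D := [set w : Omega G | has (Q^~ (window (- n%:Z) n w)) L].
have mD : measurable D by exact: (measurable_window (fun z => has (Q^~ z) L)).
have PD : (P D <= (\sum_(y <- L | even_buffer y) discrepancy phi mu n e y)%:E)%E.
  rewrite (window_law P_product (fun z => has (Q^~ z) L)) lee_fin.
  apply: le_trans (prob_has _ _ _) _; rewrite [leRHS]big_mkcond.
  apply: ler_sum => y _; rewrite /Q; case: ifP => _ //.
  by rewrite prob_false.
pose S (W : Omega G -> buffer G) := [set w | (m < buffer_size (W w))%N].
have mS (W : {mfun Omega G >-> buffer G}) : measurable (shift (- n%:Z) @^-1` S W).
  rewrite -[X in measurable X]setTI; apply: measurable_shift => //.
  exact: measurable_large.
have mE := measurable_neq U V.
apply: (@le_trans _ _ (P (shift (- n%:Z) @^-1` S U `|`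
    shift (- n%:Z) @^-1` S V `|` D `|` (A `|` B)))).
  apply: le_measure; rewrite ?inE //.
    by do ?apply: measurableU => //; exact: mS.
  move=> w /= UV; apply: contrapT.
  move=> /not_orP[/not_orP[/not_orP[SU SV] nD] /not_orP[nA nB]].
  apply: UV.
  have -> := contrapT (contra_not (HA w) nA) n.
  have -> := contrapT (contra_not (HB w) nB) n.
  have merge (W : {mfun Omega G >-> buffer G}) : Y2rv W ->
      ~ (m < buffer_size (W (shift (- n%:Z) w)))%N ->
      backward (W (shift (- n%:Z) w)) n w = backward e n w.
    move=> eW /negP; rewrite -leqNgt => /HL yL; apply/eqP; rewrite eq_sym.
    apply: contrapT => ne; apply: nD; apply/hasP; exists (W (shift (- n%:Z) w)) => //.
    by rewrite /Q eW; apply/negP.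
  by rewrite !merge.
rewrite measureU0 //; last 3 first.
- by do ?apply: measurableU => //; exact: mS.
- exact: measurableU.
- by rewrite measureU0.
apply: le_trans (measureU2 _ _ mD) _; first by apply: measurableU; exact: mS.
apply: leeD => //; apply: le_trans (measureU2 _ _ _) _; try exact: mS.
have inv (W : {mfun Omega G >-> buffer G}) :
    (P (shift (- n%:Z) @^-1` S W) <= P (S W))%E.
  by rewrite (shift_invariant P_product) //; exact: measurable_large.
exact: leeD (inv U) (inv V).
Qed.

Lemma solution_unique (U V : {mfun Omega G >-> buffer G}) :
  Y2rv U -> Y2rv V -> is_solution phi P U -> is_solution phi P V ->
  {ae P, forall w, U w = V w}.
Proof.
move=> eU eV solU solV.
have mneq : measurable [set w | U w <> V w] by exact: measurable_neq.
apply/negligibleP => //; apply/eqP; rewrite eq_le measure_ge0 andbT.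
apply/lee_addgt0Pr => r r0; rewrite add0e.
have r3 : 0 < r / 3 by rewrite divr_gt0.
have small (W : {mfun Omega G >-> buffer G}) : exists N, forall m, (N <= m)%N ->
    (P [set w | (m < buffer_size (W w))%N] <= (r / 3)%:E)%E.
  have /fine_cvgP[_ /cvgr_lt/(_ _ r3)[N _ HN]] := large_cvg0 W.
  exists N => m /HN /= /ltW; rewrite -lee_fin fineK //.
  exact: fin_num_measure (measurable_large W m).
have [N1 H1] := small U; have [N2 H2] := small V; pose m := maxn N1 N2.
have [L HL] := finite_small_buffers G m.
have /cvgr_lt/(_ _ r3)[N _ HN] := sum_discrepancy_cvg0 L.
apply: le_trans (solutions_differ_le N eU eV solU solV HL) _.
have -> : r = r / 3 + r / 3 + r / 3 by field.
rewrite !EFinD; apply: leeD; last by rewrite lee_fin ltW //; apply: HN => /=.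
by apply: leeD; [apply: H1; exact: leq_maxl|apply: H2; exact: leq_maxr].
Qed.

End Coupling.

Theorem theorem1 (R : realType) (G : graph) (phi : policy R G) (mu : G -> R)
    (P : probability (Omega G) R)
    (mu_distribution : is_distribution mu)
    (mu_full_support : forall v : G, 0 < mu v)
    (P_product : is_product_measure mu (nu phi) P)
    (phi_sub_additive : sub_additive phi)
    (h1 : H1 phi P) :
  exists U : {mfun Omega G >-> buffer G},
    [/\ Y2rv U,
        is_solution phi P U,
        (forall U' : {mfun Omega G >-> buffer G}, Y2rv U' ->
           is_solution phi P U' -> {ae P, forall w, U' w = U w}) &
        (forall Y : {mfun Omega G >-> buffer G}, Y2inf Y ->
           strong_backwards_coupling phi P Y U)].
Proof.
exists (limit_content phi); split.
- exact: limit_content_even.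
- exact: (limit_content_solution mu_distribution mu_full_support P_product).
- move=> V eV solV.
  apply: (solution_unique mu_distribution mu_full_support P_product) => //.
    exact: limit_content_even.
  exact: (limit_content_solution mu_distribution mu_full_support P_product).
- exact: (limit_content_coupling mu_distribution mu_full_support P_product).
Qed.
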